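(* Let $(M,\mathcal{C})$ be a differential space whose differential structure $\mathcal{C}$ is generated by a family $\mathcal{F}$ of real-valued functions on $M$, i.e. $\mathcal{C}=(\mathrm{sc}\,\mathcal{F})_M$, and suppose that the topological space $(M,\tau_{\mathcal{C}})$ is Hausdorff. For $k\in\mathbf{N}$, $f_1,\ldots,f_k\in\mathcal{F}$ and $\varepsilon>0$ put $$V(f_1,\ldots,f_k,\varepsilon)=\{(x,y)\in M\times M:\ |f_i(x)-f_i(y)|<\varepsilon\ \text{ for all } 1\le i\le k\},$$ and let $$\mathcal{B}=\{V(f_1,\ldots,f_k,\varepsilon)\subset M\times M:\ k\in\mathbf{N},\ f_1,\ldots,f_k\in\mathcal{F},\ \varepsilon>0\}.$$ Then $\mathcal{B}$ satisfies the following three conditions: (B1) for all $V_1,V_2\in\mathcal{B}$ there exists $V\in\mathcal{B}$ such that $V\subset V_1\cap V_2$; (B2) for every $V\in\mathcal{B}$ there exists $W\in\mathcal{B}$ such that $2W\subset V$; (B3) $\bigcap\mathcal{B}=\Delta$, where $\Delta=\{(x,x):x\in M\}$.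
   Context: Let $M$ be a nonempty set and let $\mathcal{C}$ be a family of real-valued functions on $M$. Denote by $\tau_{\mathcal{C}}$ the weakest topology on $M$ with respect to which all functions of $\mathcal{C}$ are continuous. Denote by $\mathcal{C}_M$ the set of all functions $f:M\to\mathbf{R}$ such that for every $p\in M$ there are a neighbourhood $V$ of $p$ (with respect to $\tau_{\mathcal{C}}$) and $\alpha\in\mathcal{C}$ with $f|_V=\alpha|_V$. Denote by $\mathrm{sc}\,\mathcal{C}$ the set of all functions of the form $\omega\circ(\alpha_1,\ldots,\alpha_n)$ with $n\in\mathbf{N}$, $\omega\in C^\infty(\mathbf{R}^n)$ and $\alpha_1,\ldots,\alpha_n\in\mathcal{C}$. A set $\mathcal{C}$ of real functions on $M$ is a (Sikorski) differential structure on $M$ if $\mathcal{C}=\mathcal{C}_M$ and $\mathcal{C}=\mathrm{sc}\,\mathcal{C}$; then $(M,\mathcal{C})$ is called a differential space. The differential structure generated by a set $\mathcal{F}$ of real functions on $M$ is the smallest differential structure on $M$ containing $\mathcal{F}$; it equals $(\mathrm{sc}\,\mathcal{F})_M$. For $V\subset M\times M$, define $$2V=\{(x,y)\in M\times M:\ \exists z\in M\ [(x,z)\in V\ \wedge\ (z,y)\in V]\}.$$ *)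

(* Defs.v *)
From HB Require Import structures.
From mathcomp Require Import all_boot all_order all_algebra.
From mathcomp Require Import all_classical all_reals all_analysis.
Import Order.TTheory GRing.Theory Num.Theory.
Import numFieldNormedType.Exports.

Set Implicit Arguments.
Unset Strict Implicit.
Unset Printing Implicit Defensive.

Local Open Scope classical_set_scope.
Local Open Scope ring_scope.

(** [Ck k w]: all iterated partial derivatives of [w] of order at most [k]
    exist and are continuous on the whole of R^n. *)
Fixpoint Ck (R : realType) (n k : nat) (w : 'rV[R]_n -> R) : Prop :=
  continuous w /\
  (if k is k'.+1 then
     forall i : 'I_n, (forall x, derivable w x (delta_mx 0 i)) /\
                      Ck k' ('D_(delta_mx 0 i) w)
   else True).

Definition smooth (R : realType) (n : nat) (w : 'rV[R]_n -> R) : Prop :=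
  forall k, Ck k w.

(** The carrier [M] equipped with the supremum of the initial topologies of the
    members of [C]; [tau_continuous] and [tau_weakest] below show that this is
    the weakest topology making all functions of [C] continuous. *)
Definition tau (R : realType) (M : choiceType) (C : set (M -> R)) :
    topologicalType :=
  sup_topology (fun f : {f : M -> R | C f} =>
    Topological.class (initial_topology (sval f))).

Lemma tau_continuous (R : realType) (M : choiceType) (C : set (M -> R))
  (f : M -> R) : C f -> continuous (f : tau C -> R).
Proof.
move=> Cf x; apply: (@cvg_trans _ (f @ nbhs (x : initial_topology f))).
  apply: cvg_app.
  have /cvg_sup : nbhs (x : tau C) --> (x : tau C) by exact: cvg_id.
  by move=> /(_ (exist _ f Cf)).
exact: initial_continuous.
Qed.

Lemma tau_weakest (R : realType) (M : choiceType) (C : set (M -> R))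
  (Tc : Topological M) :
  (forall f, C f -> continuous (f : Topological.Pack Tc -> R)) ->
  forall U : set M, @open (tau C) U -> @open (Topological.Pack Tc) U.
Proof.
move=> Hc U oU; rewrite openE => x Ux.
suff : nbhs (x : Topological.Pack Tc) --> (x : tau C).
  by apply; exact: open_nbhs_nbhs.
apply/cvg_sup => -[f Cf] A /=.
rewrite (@nbhsE (initial_topology f)) => -[_ [[B oB <-]] /= Bfx sBA].
apply: filterS sBA _; apply: (Hc f Cf x).
exact: open_nbhs_nbhs.
Qed.

(** The set written [C_M]; neighbourhoods are taken with respect to the topology
    induced by the very family being localized. *)
Definition localization (R : realType) (M : choiceType) (C : set (M -> R)) :
    set (M -> R) :=
  [set f | forall p : M, exists V : set M, nbhs (p : tau C) V /\
             exists2 a, C a & forall x, V x -> f x = a x].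

Definition sc (R : realType) (M : choiceType) (C : set (M -> R)) :
    set (M -> R) :=
  [set f | exists n : nat, (0 < n)%N /\
           exists w : 'rV[R]_n -> R, smooth w /\
           exists2 a : 'I_n -> M -> R, (forall i, C (a i)) &
             f = (fun p => w (\row_i a i p))].

Definition differential_structure (R : realType) (M : choiceType)
    (C : set (M -> R)) : Prop :=
  C = localization C /\ C = sc C.

Definition twice (M : Type) (V : set (M * M)) : set (M * M) :=
  [set xy | exists z, V (xy.1, z) /\ V (z, xy.2)].

Definition Vset (R : realType) (M : Type) (k : nat) (f : 'I_k -> M -> R)
    (e : R) : set (M * M) :=
  [set xy | forall i, `|f i xy.1 - f i xy.2| < e].

Definition Bfam (R : realType) (M : Type) (F : set (M -> R)) :
    set (set (M * M)) :=
  [set V | exists k : nat, (0 < k)%N /\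
           exists f : 'I_k -> M -> R, (forall i, F (f i)) /\
           exists2 e : R, 0 < e & V = Vset f e].

(* Main.v *)
(** Points not separated by [F] are not separated by [sc F] and hence lie in the
    same open sets of [tau (sc F)], so they are not separated by
    [localization (sc F)] either; if [tau] of the latter is Hausdorff they
    coincide, which gives (B3).  (B1) and (B2) only use concatenation of families
    and the triangle inequality. *)
Require Import Defs.
From HB Require Import structures.
From mathcomp Require Import all_boot all_order all_algebra.
From mathcomp Require Import all_classical all_reals all_analysis.
Import Order.TTheory GRing.Theory Num.Theory.
Import numFieldNormedType.Exports.

Local Open Scope classical_set_scope.
Local Open Scope ring_scope.

(** In each [initial_topology f], a neighbourhood of [y] contains the preimage of an open set around
    [f y]; since [f x = f y], this preimage contains [x]. *)
Lemma tau_nbhs_indistinct (R : realType) (M : choiceType) (C : set (M -> R))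
    (x y : M) (A : set M) :
  (forall f, C f -> f x = f y) -> nbhs (y : tau C) A -> A x.
Proof.
move=> fxy yA.
(* Stating the claim as convergence of the principal filter at [x] lets [cvg_sup] reduce it to one
   [f] at a time. *)
have : globally [set x] --> (y : tau C).
  apply/cvg_sup => -[f Cf] B /=.
  rewrite (@nbhsE (initial_topology f)) => -[_ [[D oD <-]] /= Dfy DB] _ ->.
  by apply: DB => /=; rewrite fxy.
by move=> /(_ _ yA); exact.
Qed.

Lemma sc_indistinct (R : realType) (M : choiceType) (F : set (M -> R))
    (x y : M) :
  (forall f, F f -> f x = f y) -> forall g, sc F g -> g x = g y.
Proof.
move=> fxy _ [n [_ [w [_ [a Fa ->]]]]].
by congr w; apply/rowP => i; rewrite !mxE fxy.
Qed.

(** A member of [C] that agrees with [g] near [y] agrees with it at [x] too, because every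
    neighbourhood of [y] contains [x]. *)
Lemma localization_indistinct (R : realType) (M : choiceType)
    (C : set (M -> R)) (x y : M) :
  (forall f, C f -> f x = f y) -> forall g, localization C g -> g x = g y.
Proof.
move=> fxy g /(_ y)[V [yV [a Ca gaV]]].
rewrite !gaV; [exact: fxy | exact: nbhs_singleton yV |].
exact: tau_nbhs_indistinct yV.
Qed.

(** The point [x] itself is common to any neighbourhood of [x] and any neighbourhood of [y]. *)
Lemma hausdorff_tau_separates (R : realType) (M : choiceType)
    (C : set (M -> R)) (x y : M) :
  hausdorff_space (tau C) -> (forall f, C f -> f x = f y) -> x = y.
Proof.
move=> hC fxy; apply: hC => A B xA yB; exists x; split.
  exact: nbhs_singleton xA.
exact: tau_nbhs_indistinct yB.
Qed.

Lemma Bfam_setI (R : realType) (M : Type) (F : set (M -> R))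
    (V1 V2 : set (M * M)) :
  Bfam F V1 -> Bfam F V2 -> exists2 V, Bfam F V & V `<=` V1 `&` V2.
Proof.
move=> [k [k0 [f [Ff [d d0 ->]]]]] [l [l0 [g [Fg [e e0 ->]]]]].
(* The first [k] indices select from [f], the last [l] from [g]; the smaller radius then serves both
   families. *)
pose h (i : 'I_(k + l)) := match fintype.split i with inl i => f i | inr j => g j end.
exists (Vset h (Num.min d e)).
  exists (k + l)%N; split; first by rewrite addn_gt0 k0.
  exists h; split; first by move=> i; rewrite /h; case: (fintype.split i).
  by exists (Num.min d e); rewrite // lt_min d0.
move=> xy hxy; split => i /=.
  have := hxy (lshift l i).
  by rewrite /h (unsplitK (inl i)) lt_min => /andP[].
have := hxy (rshift k i).
by rewrite /h (unsplitK (inr i)) lt_min => /andP[].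
Qed.

Lemma Bfam_half (R : realType) (M : Type) (F : set (M -> R))
    (V : set (M * M)) :
  Bfam F V -> exists2 W, Bfam F W & twice W `<=` V.
Proof.
move=> [k [k0 [f [Ff [e e0 ->]]]]].
exists (Vset f (e / 2)).
  exists k; split=> //; exists f; split=> //.
  by exists (e / 2); rewrite // divr_gt0.
move=> [x y] [z [xz zy]] i /=.
rewrite (le_lt_trans (ler_distD (f i z) _ _)) // [e in ltRHS]splitr.
exact: ltrD (xz i) (zy i).
Qed.

Lemma bigcap_Bfam_eq (R : realType) (M : Type) (F : set (M -> R)) (x y : M) :
  (\bigcap_(V in Bfam F) V) (x, y) <-> forall f, F f -> f x = f y.
Proof.
split=> [Bxy f Ff|fxy _ [k [_ [f [Ff [e e0 ->]]]]] i /=]; last first.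
  by rewrite fxy // subrr normr0.
apply/eqP; rewrite -subr_eq0 -normr_le0 leNgt; apply/negP => d0.
(* The distance [|f x - f y|], assumed positive, is taken as the radius: the strict inequality in
   [Vset] then fails at [(x, y)]. *)
have /Bxy/(_ ord0) : Bfam F (Vset (fun _ : 'I_1 => f) `|f x - f y|).
  by exists 1%N; split=> //; exists (fun=> f); split=> //; exists `|f x - f y|.
by rewrite /= ltxx.
Qed.

Theorem proposition3p1 (R : realType) (M : choiceType) (C F : set (M -> R))
  (M_nonempty : [set: M] !=set0)
  (C_struct : differential_structure C)
  (C_generated : C = localization (sc F))
  (C_hausdorff : hausdorff_space (tau C)) :
  [/\ (forall V1 V2, Bfam F V1 -> Bfam F V2 ->
         exists2 V, Bfam F V & V `<=` V1 `&` V2),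
      (forall V, Bfam F V -> exists2 W, Bfam F W & twice W `<=` V)
    & \bigcap_(V in Bfam F) V = [set xy : M * M | xy.1 = xy.2]].
Proof.
split; [exact: Bfam_setI | exact: Bfam_half |].
apply/seteqP; split=> -[x y] /=; last by move=> ->; exact/bigcap_Bfam_eq.
move=> /bigcap_Bfam_eq fxy; apply: hausdorff_tau_separates C_hausdorff _.
rewrite C_generated; apply: localization_indistinct.
exact: sc_indistinct.
Qed.
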